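(* Let $n\ge 2$, let $F\subset\mathbb{R}^n$ be a compact convex set with $\mathbf{0}$ in its interior, and let $\xi\in\partial F$. Assume that there are $\delta>0$ and $f:\mathbb{R}^n\to\mathbb{R}$ of class $C^2$ on $\xi+\delta\mathbf{B}$ such that $F\subset\{x\in\mathbb{R}^n: f(x)\le 0\}$, $\langle \xi,\nabla f(\xi)\rangle>0$, and such that, for $x\in\xi+\delta\mathbf{B}$, we have $x\in\partial F$ if and only if $f(x)=0$. Let $i$ be the first index in $I=\{1,\dots,n\}$ with $f_{x_i}(\xi)\ne0$ and fix $j\in I\setminus\{i\}$. Then $$\frac{\widehat{\mathfrak R}_F(\xi,u^j(\xi))}{\|\xi^*\|}=\limsup_{(\varepsilon,\eta)\to(0^+,\xi),\ \eta\in\partial F}\ \inf\Big\{r>0:\ F\cap P(\eta,u^j(\eta))\cap(\eta+\varepsilon\overline{\mathbf B})\subset \eta-r\eta^*+r\|\eta^*\|\overline{\mathbf B}\Big\}.$$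
   Context: $\langle\cdot,\cdot\rangle$ and $\|\cdot\|$ are the usual inner product and norm of $\mathbb{R}^n$, $\mathbf{B}$ is the open unit ball, $\overline{\mathbf B}$ the closed unit ball, and $f_{x_k}=\partial f/\partial x_k$. All points $\eta$ are taken close enough to $\xi$ that $\langle\eta,\nabla f(\eta)\rangle>0$ and $f_{x_i}(\eta)\ne0$. For $\eta\in\partial F$ near $\xi$: - $\eta^*:=\frac{1}{\langle\eta,\nabla f(\eta)\rangle}\nabla f(\eta)$ (in particular this defines $\xi^*$). - $u^j(\eta)$ is the vector with $1$ in the $j$th coordinate, $-\frac{f_{x_j}(\eta)}{f_{x_i}(\eta)}$ in the $i$th coordinate and $0$ in the others. - $P(\eta,u):=\eta+\operatorname{span}\{\nabla f(\eta),u\}$ for $u\ne\mathbf0$ orthogonal to $\nabla f(\eta)$. - $\widehat{\mathfrak C}_F(r,\eta,u):=\inf\{\langle\eta-y,\eta^*\rangle: y\in F\cap P(\eta,u),\ \|\eta-y\|\ge r\}$ for $r>0$. Then $$\hat\varkappa_F(\xi,u^j(\xi)):=\frac1{\|\xi^*\|}\liminf_{(r,\eta)\to(0^+,\xi),\ \eta\in\partial F}\frac{\widehat{\mathfrak C}_F(r,\eta,u^j(\eta))}{r^2},\qquad \widehat{\mathfrak R}_F(\xi,u^j(\xi)):=\frac{1}{2\hat\varkappa_F(\xi,u^j(\xi))}.$$ Values are taken in $[0,+\infty]$, with the conventions $1/0=+\infty$ and $\inf\emptyset=+\infty$. *)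

(* Defs.v *)
From HB Require Import structures.
From mathcomp Require Export all_boot all_order all_algebra.
From mathcomp Require Export all_classical all_reals all_analysis.
Export Order.TTheory GRing.Theory Num.Theory.
Export numFieldNormedType.Exports.

Set Implicit Arguments.
Unset Strict Implicit.
Unset Printing Implicit Defensive.

Local Open Scope classical_set_scope.
Local Open Scope ring_scope.

Section Euclidean.
Variables (R : realType) (n : nat).
Implicit Types (u v c x : 'rV[R]_n) (A : set 'rV[R]_n).

Definition dot u v : R := \sum_(k < n) u ord0 k * v ord0 k.

(* The library norm on ['rV[R]_n] is the sup norm; it induces the usual
   topology, but the geometry below needs the Euclidean norm. *)
Definition enorm u : R := Num.sqrt (dot u u).

Definition eball c (r : R) : set 'rV[R]_n := [set x | enorm (x - c) < r].

Definition ecball c (r : R) : set 'rV[R]_n := [set x | enorm (x - c) <= r].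

Definition boundary A : set 'rV[R]_n := closure A `\` interior A.

End Euclidean.

Section Smooth.
Variables (R : realType) (n : nat).
Implicit Types (f : 'rV[R]_n -> R^o) (x : 'rV[R]_n) (U : set 'rV[R]_n).

Definition partial (k : 'I_n) f : 'rV[R]_n -> R^o := 'D_(delta_mx ord0 k) f.

Definition grad f x : 'rV[R]_n := \row_(k < n) partial k f x.

(* [f] is of class C^m on [U]; meant for open [U]. *)
Fixpoint class_C (m : nat) U f : Prop :=
  (forall x, U x -> {for x, continuous f}) /\
  if m is m'.+1 then
    forall k : 'I_n,
      (forall x, U x -> derivable f x (delta_mx ord0 k)) /\
      class_C m' U (partial k f)
  else True.

End Smooth.

Section Curvature.
Variables (R : realType) (n : nat).
Variables (F : set 'rV[R]_n) (f : 'rV[R]_n -> R^o).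
Implicit Types (xi eta y v : 'rV[R]_n) (u : 'rV[R]_n -> 'rV[R]_n) (r : R).

(* eta^*: for eta in the boundary of F near xi, an outer normal to F at eta
   scaled so that <eta, eta^*> = 1. *)
Definition dual eta : 'rV[R]_n := (dot eta (grad f eta))^-1 *: grad f eta.

Definition tangent (i j : 'I_n) eta : 'rV[R]_n :=
  \row_(k < n) if k == j then 1
               else if k == i then - (partial j f eta / partial i f eta)
               else 0.

Definition plane eta v : set 'rV[R]_n :=
  [set y | y - eta \in <<[:: grad f eta; v]>>%VS].

Definition rotundity r eta v : \bar R :=
  ereal_inf [set (dot (eta - y) (dual eta))%:E |
             y in [set y | (F `&` plane eta v) y /\ r <= enorm (eta - y)]].

(* (r, eta) -> (0^+, xi) with eta in the boundary of F; eta = xi is allowed *)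
Definition to_boundary_point xi : set_system (R * 'rV[R]_n) :=
  filter_prod (0 : R)^'+ (within (boundary F) (nbhs xi)).

(* Both quantities depend on the tangent direction at all boundary points near
   [xi], so they take a field [u] of directions rather than [u xi] alone. *)
Definition curvature u xi : \bar R :=
  ((enorm (dual xi))%:E^-1 *
   limf_einf (fun p : R * 'rV[R]_n =>
                rotundity p.1 p.2 (u p.2) / (p.1 ^+ 2)%:E)
             (to_boundary_point xi))%E.

(* On [\bar R], [x^-1] is [+oo] at [0] and [0] at [+oo]. *)
Definition curvature_radius u xi : \bar R := ((2%:E * curvature u xi)^-1)%E.

Definition local_radius (eps : R) eta v : \bar R :=
  ereal_inf [set r%:E | r in
    [set r : R | 0 < r /\
       F `&` plane eta v `&` ecball eta eps `<=`
         ecball (eta - r *: dual eta) (r * enorm (dual eta))]].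

End Curvature.

(* Main.v *)
Require Import Defs.
From mathcomp Require Import ring lra.

(** For [y] in [F] and in the plane [P(eta, u)], put
[Q(y) = <eta - y, eta^*> / |eta - y|^2], where [y <> eta]. The numerator is
the distance from [y] to the hyperplane tangent at [eta], up to the factor
[|eta^*|], and both sides of the formula are read off from [Q].

- By [ecball_tangentE], [y] lies in the ball of radius [r |eta^*|] tangent at
  [eta] exactly when [1 <= 2 r Q(y)]. Hence the local radius at [(eps, eta)]
  is [1 / (2 m)], where [m] is the infimum of [Q] over [0 < |eta - y| <= eps].
- The quotient of the rotundity by [r^2] is the infimum of [Q] over
  [|eta - y| = r]: by convexity a point at a larger distance can be pulled
  towards [eta], and this decreases the numerator, provided that it is
  nonnegative.

So [m] is the infimum over [0 < r <= eps] of the quotients of the second item,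
and taking an infimum over smaller radii does not change the lower limit at
[(0^+, xi)]. If [L] denotes this common lower limit, the right-hand side is
[1 / (2 L)]; the left-hand side is the same number, because the two factors
[|xi^*|] cancel. The lemmas [local_radius_le] and [rotundity_ge] state the
two halves of the comparison as implications between real bounds, which
[limf_esup_local_radius] turns into the equality of the limits.

What remains is that the numerator is nonnegative, i.e. that [eta^*] is an
outer normal to [F] at the boundary points [eta] near [xi]. Since [f <= 0] on
[F] and [f eta = 0], this follows from the formula [<v, grad f eta>] for the
derivative of [f] at [eta] in the direction [v] ([cvg_slope_grad]), a
consequence of the continuity of the partial derivatives. *)

Set Implicit Arguments.
Unset Strict Implicit.
Unset Printing Implicit Defensive.

Local Open Scope classical_set_scope.
Local Open Scope ring_scope.

(** * Directional derivatives from continuous partial derivatives *)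

Lemma is_derive_line (R : realType) (V : normedModType R) (f : V -> R^o)
    (x e : V) (s : R) :
  derivable f (s *: e + x) e ->
  is_derive s (1 : R) (fun t : R => f (t *: e + x)) ('D_e f (s *: e + x)).
Proof.
move=> df.
have E : (fun h : R => h^-1 *: (((fun t : R => f (t *: e + x)) \o shift s)
            (h *: (1 : R)) - f (s *: e + x))) =
         (fun h => h^-1 *: ((f \o shift (s *: e + x)) (h *: e)
            - f (s *: e + x))).
  apply/funext => h /=; congr (_ *: (f _ - _)).
  by rewrite scalerDl addrA [h *: 1]mulr1.
by split; rewrite /derivable /derive E.
Qed.

(** The sign of [a] is left free and the intermediate point is only located
by its absolute value, so that increments of either sign are estimated at
once. *)
Lemma MVT_origin (R : realType) (g dg : R -> R) (a : R) :
  (forall s, `|s| <= `|a| -> is_derive s (1 : R) g (dg s)) ->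
  exists2 c, `|c| <= `|a| & g a - g 0 = dg c * a.
Proof.
move=> dgP.
have gc s : `|s| <= `|a| -> {for s, continuous g}.
  move=> /dgP[+ _] => /derivable1_diffP.
  exact: differentiable_continuous.
have mvt x y : x <= y -> (forall s, s \in `[x, y] -> `|s| <= `|a|) ->
    exists2 c, `|c| <= `|a| & g y - g x = dg c * (y - x).
  move=> xy sub.
  have [//|||c /sub cP ->] := @MVT_segment R g dg x y; last by exists c.
  - by move=> s /subset_itv_oo_cc /sub /dgP.
  - apply: continuous_in_subspaceT => s; rewrite inE => /sub; exact: gc.
have [a0|a0] := leP 0 a.
  have [|c ca E] := mvt 0 a a0; last by exists c; rewrite ?E ?subr0.
  by move=> s; rewrite in_itv/= => /andP[s0 sa]; rewrite !ger0_norm.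
have [|c ca E] := mvt a 0 (ltW a0).
  by move=> s; rewrite in_itv/= => /andP[s0 sa]; rewrite !ler0_norm ?lerN2// ltW.
by exists c => //; rewrite -opprB E sub0r mulrN opprK.
Qed.

(** The increment of [f] in the direction [e] is taken at the base point
[h *: w + x], which moves with [h]. By the mean value theorem it equals
[h * c] times ['D_e f] at a point within [O(h)] of [x], and continuity of
['D_e f] at [x] gives the limit. The moving base point is what makes these
limits add up along a broken line. *)
Lemma cvg_slope_direction (R : realType) (V : normedModType R) (f : V -> R^o)
    (x w e : V) (c : R) :
  (\forall y \near x, derivable f y e) -> {for x, continuous ('D_e f)} ->
  (h^-1 * (f (h *: (w + c *: e) + x) - f (h *: w + x))) @[h --> (0:R)^'] -->
    c * 'D_e f x.
Proof.
move=> df cf; apply/cvgrPdist_le => eps eps0.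
have c1 : 0 < `|c| + 1 by rewrite ltr_wpDl.
have e0 : 0 < eps / (`|c| + 1) by rewrite divr_gt0.
have /cvgrPdist_le/(_ _ e0) near_df : 'D_e f y @[y --> x] --> 'D_e f x := cf.
have [rho/= rho0 sub] : nbhs_ball x (fun y => derivable f y e /\
    `|'D_e f x - 'D_e f y| <= eps / (`|c| + 1)).
  by apply/nbhs_ballP; near=> y; split; near: y.
near=> h.
have h0 : h != 0 by near: h; exact: nbhs_dnbhs_neq.
have in_ball s : `|s| <= `|h * c| -> ball x rho (s *: e + (h *: w + x)).
  move=> sP; rewrite -ball_normE /= addrA opprD addrCA subrr addr0 normrN.
  apply: (@le_lt_trans _ _ (`|h| * (`|c| * `|e| + `|w|))).
    rewrite (le_trans (ler_normD _ _))// !normrZ mulrDr lerD2r// mulrA -normrM.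
    by rewrite ler_wpM2r.
  (* The displacement is at most [|h| (|c| |e| + |w|)]; the extra 1 keeps the
     divisor positive. *)
  have hK : `|h| < rho / (`|c| * `|e| + `|w| + 1).
    by near: h; apply: dnbhs0_lt; rewrite divr_gt0// ltr_wpDl ?addr_ge0.
  apply: le_lt_trans (_ : `|h| * (`|c| * `|e| + `|w| + 1) < rho).
    by rewrite ler_wpM2l// lerDl.
  by rewrite -ltr_pdivlMr// ltr_wpDl ?addr_ge0.
have dline s : `|s| <= `|h * c| -> is_derive s (1 : R)
    (fun t : R => f (t *: e + (h *: w + x))) ('D_e f (s *: e + (h *: w + x))).
  by move=> /in_ball/sub[dfs _]; exact: is_derive_line.
have [s sP] := MVT_origin dline.
have -> : h *: (w + c *: e) + x = (h * c) *: e + (h *: w + x).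
  by rewrite scalerDr scalerA addrCA addrA.
rewrite scale0r add0r => ->.
rewrite [h^-1 * _]mulrC -mulrA mulrAC mulfV// mul1r [_ * c]mulrC -mulrBr normrM.
have [_] := sub _ (in_ball _ sP).
rewrite ler_pdivlMr// => /(le_trans _); apply.
by rewrite mulrC ler_wpM2l// lerDl.
Unshelve. all: by end_near. Qed.

Section Gradient.
Variables (R : realType) (n : nat).
Implicit Types (f : 'rV[R]_n -> R^o) (x v : 'rV[R]_n).

(** Continuous partial derivatives give every directional derivative: the
segment from [x] to [h *: v + x] is replaced by a broken line that changes one
coordinate at a time, and each edge contributes one term of the inner
product. *)
Lemma cvg_slope_grad f x v :
  (forall k, \forall y \near x, derivable f y (delta_mx ord0 k)) ->
  (forall k, {for x, continuous (partial k f)}) ->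
  (h^-1 * (f (h *: v + x) - f x)) @[h --> (0:R)^'] --> dot v (grad f x).
Proof.
move=> df cf.
have vE : v = \sum_(k < n) v ord0 k *: delta_mx ord0 k := row_sum_delta v.
rewrite [v in X in X @ _]vE {vE}.
have -> : dot v (grad f x) =
    \sum_(k < n) v ord0 k * 'D_(delta_mx ord0 k) f x.
  by apply: eq_bigr => k _; rewrite mxE.
elim: (index_enum _) => [|k s IH].
  rewrite big_nil; apply: cvg_near_cst; near=> h.
  by rewrite big_nil scaler0 add0r subrr mulr0.
rewrite !big_cons [v ord0 k * _ + _]addrC [v ord0 k *: _ + _]addrC.
(* The edge along coordinate [k], once the coordinates of [s] have moved. *)
have step := @cvg_slope_direction _ _ f x
  (\sum_(i <- s) v ord0 i *: delta_mx ord0 i) _ (v ord0 k) (df k) (cf k).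
have sum := cvgD IH step.
apply: cvg_trans (sum _).
apply: near_eq_cvg; near=> h.
rewrite /= -[LHS]mulrDr.
have tel (a b c : R) : b - a + (c - b) = c - a by lra.
by congr (_ * _); exact: tel.
Unshelve. all: by end_near. Qed.

Lemma dot_grad_le0 f x v :
  (forall k, \forall y \near x, derivable f y (delta_mx ord0 k)) ->
  (forall k, {for x, continuous (partial k f)}) ->
  (\forall h \near 0^'+, f (h *: v + x) <= f x) ->
  dot v (grad f x) <= 0.
Proof.
move=> df cf fle.
have slope := cvg_dnbhs_at_right (@cvg_slope_grad f x v df cf).
apply: cvgr_to_le slope _; near=> h.
rewrite pmulr_rle0 ?subr_le0 ?invr_gt0; first by near: h.
by near: h; exact: nbhs_right_gt.
Unshelve. all: by end_near. Qed.

End Gradient.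

(** * The Euclidean inner product *)

Section Dot.
Variables (R : realType) (n : nat).
Implicit Types (d u v w x y : 'rV[R]_n) (a r : R).

Lemma dotC u v : dot u v = dot v u.
Proof. by apply: eq_bigr => k _; rewrite mulrC. Qed.

Lemma dotDl u v w : dot (u + v) w = dot u w + dot v w.
Proof. by rewrite -big_split; apply: eq_bigr => k _; rewrite mxE mulrDl. Qed.

Lemma dotZl a u v : dot (a *: u) v = a * dot u v.
Proof. by rewrite mulr_sumr; apply: eq_bigr => k _; rewrite mxE mulrA. Qed.

Lemma dotNl u v : dot (- u) v = - dot u v.
Proof. by rewrite -scaleN1r dotZl mulN1r. Qed.

Lemma dotZr a u v : dot u (a *: v) = a * dot u v.
Proof. by rewrite dotC dotZl dotC. Qed.

Lemma dotDr u v w : dot u (v + w) = dot u v + dot u w.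
Proof. by rewrite dotC dotDl !(dotC u). Qed.

Lemma dotBB u v : dot (u - v) (u - v) = dot u u - 2 * dot u v + dot v v.
Proof.
rewrite dotDl !dotDr !dotNl [dot u (- v)]dotC [dot v (- v)]dotC !dotNl.
by rewrite [dot v u]dotC; lra.
Qed.

Lemma dotuu_ge0 u : 0 <= dot u u.
Proof. by apply: sumr_ge0 => k _; rewrite -expr2 sqr_ge0. Qed.

Lemma enorm_ge0 u : 0 <= enorm u.
Proof. exact: sqrtr_ge0. Qed.

Lemma enorm_sqr u : enorm u ^+ 2 = dot u u.
Proof. by rewrite sqr_sqrtr// dotuu_ge0. Qed.

Lemma enorm_eq0 u : enorm u = 0 -> u = 0.
Proof.
move=> u0; have /eqP : dot u u = 0 by rewrite -enorm_sqr u0 expr0n.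
rewrite psumr_eq0 => [/allP uu0|k _]; last by rewrite -expr2 sqr_ge0.
apply/rowP => k; rewrite mxE; apply/eqP.
by have := uu0 k (mem_index_enum _); rewrite mulf_eq0 orbb.
Qed.

Lemma enormZ a u : 0 <= a -> enorm (a *: u) = a * enorm u.
Proof.
move=> a0; rewrite /enorm dotZl dotZr mulrA -expr2 sqrtrM ?sqr_ge0//.
by rewrite sqrtr_sqr ger0_norm.
Qed.

Lemma enormB u v : enorm (u - v) = enorm (v - u).
Proof.
by rewrite -opprB /enorm dotNl dotC dotNl opprK.
Qed.

(** The ball of radius [r |d|] centred at [x - r *: d] is the ball through [x]
whose outer normal there is [d]. Expanding the square turns membership of [y]
into a bound on the quotient of the gap [<x - y, d>] by [|x - y|^2]. *)
Lemma ecball_tangentE x d r y : 0 < r ->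
  ecball (x - r *: d) (r * enorm d) y <->
  enorm (x - y) ^+ 2 <= 2 * r * dot (x - y) d.
Proof.
move=> r0; rewrite /ecball /=.
have -> : y - (x - r *: d) = r *: d - (x - y).
  by rewrite !opprB addrCA.
rewrite -[r * _]enormZ; last exact: ltW.
rewrite -[enorm _ <= _]ler_sqr ?nnegrE ?enorm_ge0// !enorm_sqr.
rewrite [dot (_ - (x - y)) _]dotBB [dot (r *: d) (x - y)]dotZl (dotC d (x - y)).
by split; lra.
Qed.

Lemma convex_set_segment (F : set 'rV[R]_n) x y a :
  convex_set F -> F x -> F y -> 0 <= a <= 1 -> F (a *: (y - x) + x).
Proof.
move=> cF Fx Fy /andP[a0 a1].
have := cF y x (Itv01 a0 a1); rewrite !inE => /(_ Fy Fx).
rewrite /conv/= /unstable.onem scalerBl scale1r.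
by rewrite scalerBr addrAC addrA.
Qed.

Lemma continuous_dot (T : topologicalType) (g h : T -> 'rV[R]_n) (t : T) :
  (forall k, {for t, continuous (fun s => g s ord0 k)}) ->
  (forall k, {for t, continuous (fun s => h s ord0 k)}) ->
  {for t, continuous (fun s => dot (g s) (h s))}.
Proof.
move=> cg ch; rewrite /dot /prop_for /continuous_at.
apply: cvg_big => [|k _]; first exact: add_continuous.
by apply: cvgM; [exact: cg|exact: ch].
Qed.

Lemma eball_nbhs x r : 0 < r -> nbhs x (eball x r).
Proof.
move=> r0.
have cB k : {for x, continuous (fun y : 'rV[R]_n => (y - x) ord0 k)}.
  apply: (@continuous_comp _ _ _ (fun y => y - x)
    (fun u : 'rV[R]_n => u ord0 k)); last exact: coord_continuous.
  by apply: continuousB; [exact: cvg_id|exact: cst_continuous].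
have c : {for x, continuous (fun y => enorm (y - x))}.
  apply: (@continuous_comp _ _ _ (fun y => dot (y - x) (y - x)) Num.sqrt).
    by apply: continuous_dot => k; exact: cB.
  exact: sqrt_continuous.
have /cvgr_lt : enorm (y - x) @[y --> x] --> enorm (x - x) := c.
apply; rewrite subrr /enorm.
by rewrite -(scale0r x) dotZl mul0r sqrtr0.
Qed.

End Dot.

(** * Supporting hyperplanes *)

Section Support.
Variables (R : realType) (n : nat) (F : set 'rV[R]_n) (f : 'rV[R]_n -> R^o).
Implicit Types (x y eta xi : 'rV[R]_n).

(** Along the segment from [eta] to a point of [F] the function stays below
[0 = f eta], so its one-sided derivative at [eta] is nonpositive. *)
Lemma grad_support eta y :
  (forall k, \forall x \near eta, derivable f x (delta_mx ord0 k)) ->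
  (forall k, {for eta, continuous (partial k f)}) ->
  convex_set F -> F `<=` [set x | f x <= 0] -> F eta -> f eta = 0 -> F y ->
  0 <= dot (eta - y) (grad f eta).
Proof.
move=> df cf cF Fle Feta feta Fy; rewrite -opprB dotNl oppr_ge0.
apply: dot_grad_le0 => //; near=> h; rewrite feta; apply: Fle.
apply: convex_set_segment => //; apply/andP; split.
  by near: h; exact: nbhs_right_ge.
by near: h; exact: nbhs_right_le.
Unshelve. all: by end_near. Qed.

(** Positivity of [<eta, grad f eta>] persists near [xi] by continuity, so
[dual f eta] is a positive multiple of the gradient and supports [F] at
[eta]. *)
Lemma near_dual_support xi (delta : R) :
  compact F -> convex_set F -> F `<=` [set x | f x <= 0] ->
  0 < delta -> class_C 1 (eball xi delta) f -> 0 < dot xi (grad f xi) ->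
  (forall x, eball xi delta x -> boundary F x -> f x = 0) ->
  \forall eta \near within (boundary F) (nbhs xi),
    F eta /\ forall y, F y -> 0 <= dot (eta - y) (dual f eta).
Proof.
move=> kF cF Fle delta0 [_ C1] xi0 bdF.
have clF : closed F := compact_closed (@norm_hausdorff _ _) kF.
have ball_xi := eball_nbhs xi delta0.
rewrite near_withinE; near=> eta => Beta.
have Feta : F eta by apply: clF; case: Beta.
split=> // y Fy; rewrite /dual dotZr mulr_ge0 ?invr_ge0//.
  apply: ltW; near: eta.
  have c : {for xi, continuous (fun x => dot x (grad f x))}.
    apply: continuous_dot => k; first exact: coord_continuous.
    have -> : (fun s => grad f s ord0 k) = partial k f.
      by apply/funext => s; rewrite mxE.
    by apply: (C1 k).2.1; exact: nbhs_singleton ball_xi.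
  have /cvgr_gt : dot x (grad f x) @[x --> xi] --> dot xi (grad f xi) := c.
  by apply.
have ball_eta : nbhs eta (eball xi delta).
  by near: eta; exact: nbhs_interior.
apply: grad_support => //.
- by move=> k; apply: filterS ball_eta => x; exact: (C1 k).1.
- by move=> k; apply: (C1 k).2.1; exact: nbhs_singleton ball_eta.
- by apply: bdF => //; exact: nbhs_singleton ball_eta.
Unshelve. all: by end_near. Qed.

End Support.

(** * Rotundity and the radius of tangent balls *)

Section Bounds.
Variables (R : realType) (n : nat) (F : set 'rV[R]_n) (f : 'rV[R]_n -> R^o).
Implicit Types (x y eta v : 'rV[R]_n) (a b r eps : R).

(** Each point [y] is tested against the rotundity at its own distance
[r = |eta - y|], which gives [a * |eta - y|^2 <= <eta - y, eta^*>]; by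
[ecball_tangentE] the radius [1 / (2 a)] is then admissible. *)
Lemma local_radius_le eta v eps a :
  (forall y, F y -> 0 <= dot (eta - y) (dual f eta)) ->
  0 < a ->
  (forall r, 0 < r <= eps ->
     (a%:E <= rotundity F f r eta v / (r ^+ 2)%:E)%E) ->
  (local_radius F f eps eta v <= ((2 * a)^-1)%:E)%E.
Proof.
move=> supp a0 rot_ge; apply: ereal_inf_lbound; exists (2 * a)^-1 => //.
have a2 : 0 < 2 * a by rewrite mulr_gt0.
split; first by rewrite invr_gt0.
move=> y [[Fy Py]]; rewrite /ecball/= enormB => y_eps.
apply/ecball_tangentE; first by rewrite invr_gt0.
rewrite invfM mulrA mulfV// mul1r mulrC ler_pdivlMr// mulrC.
have [->|y_eta] := eqVneq (enorm (eta - y)) 0.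
  by rewrite expr0n mulr0 supp.
have y0 : 0 < enorm (eta - y) by rewrite lt_neqAle eq_sym y_eta enorm_ge0.
rewrite -lee_fin EFinM -lee_pdivlMr ?exprn_gt0//.
have /rot_ge/le_trans : 0 < enorm (eta - y) <= eps by rewrite y0.
apply; rewrite inver expf_eq0 /= gt_eqF//.
rewrite lee_pmul2r ?lte_fin ?invr_gt0 ?exprn_gt0//.
by apply: ereal_inf_lbound; exists y.
Qed.

(** Convexity enters here. A point [y] at distance at least [eps] is pulled
towards [eta] to a point [z] at distance exactly [eps], where a radius [r < b]
bounds the gap from below by [eps^2 / (2 r)]. The gap is linear along the
segment and nonnegative, so the gap at [y] is at least as large. *)
Lemma rotundity_ge eta v eps b :
  convex_set F -> F eta ->
  (forall y, F y -> 0 <= dot (eta - y) (dual f eta)) ->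
  0 < eps -> (local_radius F f eps eta v < b%:E)%E ->
  (((2 * b)^-1)%:E <= rotundity F f eps eta v / (eps ^+ 2)%:E)%E.
Proof.
move=> cF Feta supp eps0 /ereal_inf_lt[_ [r [r0 sub] <-]]; rewrite lte_fin => rb.
have b0 : 0 < b := lt_trans r0 rb.
rewrite inver expf_eq0 /= gt_eqF//= lee_pdivlMr ?exprn_gt0// -EFinM.
apply: le_ereal_inf_tmp => _ [y [[Fy Py] eps_y] <-]; rewrite lee_fin.
have y0 : 0 < enorm (eta - y) := lt_le_trans eps0 eps_y.
set t := eps / enorm (eta - y).
have t0 : 0 < t by rewrite divr_gt0.
have t1 : t <= 1 by rewrite ler_pdivrMr// mul1r.
set z := t *: (y - eta) + eta.
have etaz : eta - z = t *: (eta - y).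
  by rewrite /z opprD addrCA subrr addr0 -scalerN opprB.
have zeps : enorm (eta - z) = eps by rewrite etaz enormZ ?ltW// divfK// gt_eqF.
have /sub/ecball_tangentE -/(_ r0) : (F `&` plane f eta v `&` ecball eta eps) z.
  split; last by rewrite /ecball/= enormB zeps.
  split; first by apply: convex_set_segment => //; rewrite ltW.
  by rewrite /plane/= /z addrK memvZ.
rewrite zeps etaz dotZl => bound.
rewrite mulrC ler_pdivrMr ?mulr_gt0//; apply: le_trans bound _.
have d0 := supp _ Fy.
rewrite mulrA mulrC ler_wpM2l//.
apply: le_trans (_ : 2 * r <= _); last by rewrite ler_wpM2l// ltW.
by rewrite ler_piMr// mulr_ge0// ltW.
Qed.

End Bounds.

(** * Reciprocals and limits of extended real functions *)

Section LimitBounds.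
Context {R : realType} {T : choiceType} {X : filteredType T}.
Variables (G : set_system X) (g : X -> \bar R).
Local Open Scope ereal_scope.

Lemma limf_esup_le x : (\forall p \near G, g p <= x) -> limf_esup g G <= x.
Proof.
move=> gx; rewrite limf_esupE.
apply: (@le_trans _ _ (ereal_sup (g @` [set p | g p <= x]))).
  by apply: ereal_inf_lbound; exists [set p | g p <= x].
by apply: ge_ereal_sup => _ [p /= px <-].
Qed.

Lemma limf_einf_ge x : (\forall p \near G, x <= g p) -> x <= limf_einf g G.
Proof.
move=> gx; rewrite limf_einfE.
apply: (@le_trans _ _ (ereal_inf (g @` [set p | x <= g p]))).
  by apply: le_ereal_inf_tmp => _ [p /= px <-].
by apply: ereal_sup_ubound; exists [set p | x <= g p].
Qed.

Lemma limf_esup_lt x : Filter G ->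
  limf_esup g G < x -> \forall p \near G, g p < x.
Proof.
move=> FG; rewrite limf_esupE => /ereal_inf_lt[_ [V GV <-]] supx.
apply: filterS GV => p Vp; apply: le_lt_trans supx.
by apply: ereal_sup_ubound; exists p.
Qed.

Lemma limf_einf_gt x : Filter G ->
  x < limf_einf g G -> \forall p \near G, x < g p.
Proof.
move=> FG; rewrite limf_einfE => /ereal_sup_gt[_ [V GV <-]] infx.
apply: filterS GV => p Vp; apply: (lt_le_trans infx).
by apply: ereal_inf_lbound; exists p.
Qed.

End LimitBounds.

Section Reciprocal.
Variable R : realType.
Implicit Types (x y K S : \bar R) (a b c : R).
Local Open Scope ereal_scope.

Lemma lte_dense_pos x y : 0 <= x -> x < y ->
  exists2 b, (0 < b)%R & x < b%:E < y.
Proof.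
case: x y => [s| |] [t| |] //; rewrite ?lee_fin ?lte_fin => s0 st.
  by exists ((s + t) / 2)%R; rewrite ?lte_fin; first lra; apply/andP; split; lra.
by exists (s + 1)%R; rewrite ?lte_fin ?ltry ?andbT; lra.
Qed.

Lemma inve_double_lt K b : 0 <= K -> (0 < b)%R ->
  ((2%:E * K)^-1 < b%:E) = (((2 * b)^-1)%:E < K).
Proof.
move=> K0 b0; rewrite inve_plt ?inE/= ?mule_ge0 ?lee_fin ?(ltW b0)//.
by rewrite invfM EFinM lte_pdivrMl// inver gt_eqF.
Qed.

Lemma inve_double_gt K b : 0 <= K -> (0 < b)%R ->
  (b%:E < (2%:E * K)^-1) = (K < ((2 * b)^-1)%:E).
Proof.
move=> K0 b0; rewrite inve_pgt ?inE/= ?mule_ge0 ?lee_fin ?(ltW b0)//.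
by rewrite invfM EFinM lte_pdivlMl// inver gt_eqF.
Qed.

(** Both inequalities are tested on positive reals only, so bounds between
reals settle the equality even where [K] or [S] is [0] or [+oo]. *)
Lemma eq_inve_double K S : 0 <= K -> 0 <= S ->
  (forall a, (0 < a)%R -> a%:E < K -> S <= ((2 * a)^-1)%:E) ->
  (forall b, (0 < b)%R -> S < b%:E -> ((2 * b)^-1)%:E <= K) ->
  (2%:E * K)^-1 = S.
Proof.
move=> K0 S0 S_le K_ge; apply/eqP; rewrite eq_le !leNgt; apply/andP; split.
  apply/negP => /(lte_dense_pos S0)[b b0 /andP[/(K_ge _ b0)]].
  by rewrite inve_double_gt// leNgt => /negbTE->.
have I0 : 0 <= (2%:E * K)^-1 by rewrite inve_ge0 mule_ge0.
apply/negP => /(lte_dense_pos I0)[b b0]; rewrite inve_double_lt// => /andP[bK].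
have a0 : (0 < (2 * b)^-1)%R by rewrite invr_gt0 mulr_gt0.
apply/negP; rewrite -leNgt; apply: (le_trans (S_le _ a0 bK)).
by rewrite lee_fin invfM invrK mulrA mulVf// mul1r.
Qed.

Lemma inve_double_scale K c : 0 <= K -> (0 < c)%R ->
  (2%:E * (c%:E^-1 * K))^-1 / c%:E = (2%:E * K)^-1.
Proof.
move=> K0 c0; rewrite inver gt_eqF//.
case: K K0 => [k| |]//; last first.
  by rewrite gt0_muley ?lte_fin ?invr_gt0// gt0_muley// invey mul0e.
rewrite lee_fin le_eqVlt => /predU1P[<-|k0].
  by rewrite !mule0 inve0 gt0_mulye// lte_fin invr_gt0.
rewrite -!EFinM !inver !mulf_eq0 invr_eq0 !gt_eqF//= -EFinM.
by rewrite !invfM invrK; congr (_%:E); field; rewrite !gt_eqF.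
Qed.

End Reciprocal.

(** * The curvature radius as an upper limit *)

Section Comparison.
Variables (R : realType) (n : nat) (F : set 'rV[R]_n) (f : 'rV[R]_n -> R^o).
Variables (u : 'rV[R]_n -> 'rV[R]_n) (xi : 'rV[R]_n).

Let G := to_boundary_point F xi.
Let ratio (p : R * 'rV[R]_n) : \bar R :=
  (rotundity F f p.1 p.2 (u p.2) / (p.1 ^+ 2)%:E)%E.
Let radius (p : R * 'rV[R]_n) : \bar R := local_radius F f p.1 p.2 (u p.2).

(** A lower bound [a] for [ratio] near [(0^+, xi)] gives the upper bound
[1 / (2 a)] for [radius] there, and conversely. The first implication uses the
lower bound at every radius up to [eps], hence the product shape of the
neighbourhoods. *)
Lemma limf_esup_local_radius :
  convex_set F -> boundary F xi ->
  (\forall eta \near within (boundary F) (nbhs xi),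
     F eta /\ forall y, F y -> 0 <= dot (eta - y) (dual f eta)) ->
  (0 <= limf_einf ratio G)%E /\
  ((2%:E * limf_einf ratio G)^-1 = limf_esup radius G)%E.
Proof.
move=> cF Bxi supp.
have closure_bd : closure (boundary F) xi by exact: subset_closure.
have properG : ProperFilter G.
  by apply: filter_prod_proper; exact: within_nbhs_proper.
have good : \forall p \near G, 0 < p.1 /\
    (F p.2 /\ forall y, F y -> 0 <= dot (p.2 - y) (dual f p.2)).
  exists ([set r | 0 < r], [set eta | F eta /\
      forall y, F y -> 0 <= dot (eta - y) (dual f eta)]) => //=.
  by split => //; exact: nbhs_right_gt.
have ratio_ge0 : (0 <= limf_einf ratio G)%E.
  apply: limf_einf_ge; apply: filterS good => p [p0 [_ suppp]].
  rewrite mule_ge0 ?inve_ge0 ?lee_fin ?sqr_ge0//.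
  apply: le_ereal_inf_tmp => _ [y [[Fy _] _] <-].
  by rewrite lee_fin suppp.
split=> //; apply: eq_inve_double => //.
(* A proper filter excludes the value [-oo] of the upper limit. *)
- apply: limf_esup_ge0; first exact: filter_not_empty.
  move=> p; apply: le_ereal_inf_tmp => _ [r [r0 _] <-].
  by rewrite lee_fin ltW.
- move=> a a0 /limf_einf_gt [[A B] /= [A0 B0] AB].
  have [rho rho0 ltA] : nbhs_ball (0 : R) (fun r => 0 < r -> A r).
    by apply/nbhs_ballP; move: A0; rewrite /at_right /within.
  apply: limf_esup_le.
  exists ([set r | 0 < r < rho], B `&` [set eta | F eta /\
      forall y, F y -> 0 <= dot (eta - y) (dual f eta)]) => /=.
    split; last exact: filterI.
    near=> r; apply/andP; split; near: r; first exact: nbhs_right_gt.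
    exact: nbhs_right_lt.
  move=> [eps eta] /= [/andP[eps0 eps_rho] [Beta [_ suppeta]]].
  apply: local_radius_le => // r /andP[r0 r_eps].
  apply: ltW; apply: (AB (r, eta)); split=> //=; apply: ltA => //=.
  by rewrite /ball/= sub0r normrN gtr0_norm// (le_lt_trans r_eps).
- move=> b b0 /limf_esup_lt lt_b; apply: limf_einf_ge.
  apply: filterS2 lt_b good => -[eps eta] /= lt_beta [eps0 [Feta suppeta]].
  exact: rotundity_ge.
Unshelve. all: by end_near. Qed.

End Comparison.

Lemma enorm_dual_gt0 (R : realType) (n : nat) (f : 'rV[R]_n -> R^o)
    (x : 'rV[R]_n) :
  0 < dot x (grad f x) -> 0 < enorm (dual f x).
Proof.
move=> x0; rewrite lt_neqAle enorm_ge0 andbT eq_sym.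
apply/eqP => /enorm_eq0 dual0.
have : dot x (dual f x) = 1 by rewrite /dual dotZr mulVf// gt_eqF.
rewrite dual0 -(scale0r x) dotZr mul0r => /esym/eqP.
by rewrite oner_eq0.
Qed.

Theorem proposition7 (R : realType) (n : nat) (F : set 'rV[R]_n)
    (xi : 'rV[R]_n) (delta : R) (f : 'rV[R]_n -> R^o) (i j : 'I_n) :
  (2 <= n)%N ->
  compact F -> convex_set F -> interior F 0 -> boundary F xi ->
  0 < delta ->
  class_C 2 (eball xi delta) f ->
  F `<=` [set x | f x <= 0] ->
  0 < dot xi (grad f xi) ->
  (forall x, eball xi delta x -> (boundary F x <-> f x = 0)) ->
  partial i f xi <> 0 ->
  (forall k : 'I_n, (k < i)%N -> partial k f xi = 0) ->
  j != i ->
  (curvature_radius F f (tangent f i j) xi / (enorm (dual f xi))%:E =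
   limf_esup (fun p : R * 'rV[R]_n =>
                local_radius F f p.1 p.2 (tangent f i j p.2))
             (to_boundary_point F xi))%E.
Proof.
move=> _ kF cF _ Bxi delta0 C2 Fle xi0 bdF _ _ _.
have C1 : class_C 1 (eball xi delta) f.
  by case: C2 => cf dfk; split=> // k; have [dk [ck _]] := dfk k.
have supp : \forall eta \near within (boundary F) (nbhs xi),
    F eta /\ forall y, F y -> 0 <= dot (eta - y) (dual f eta).
  by apply: near_dual_support C1 xi0 _ => // x /bdF[].
have [ratio_ge0 <-] :=
  limf_esup_local_radius (tangent f i j) cF Bxi supp.
by rewrite inve_double_scale// enorm_dual_gt0.
Qed.
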